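(* Let $K=K(X,\mathcal M,\alpha,r)$ be the PoSI constant. For every (measurable) model selection procedure $\hat M:\mathbb R^n\to\mathcal M$, writing $\hat M=\hat M(Y)$, $$P\bigl[\beta_{j\cdot\hat M}\in \mathrm{CI}_{j\cdot\hat M}(K)\ \ \forall j\in\hat M\bigr]\ \ge\ 1-\alpha .$$
   Context: Setting. $X=(X_1,\dots,X_p)$ is a fixed real $n\times p$ matrix with $d=\operatorname{rank}(X)\ge 1$ ($n,p$ arbitrary). $Y\sim N(\mu,\sigma^2 I_n)$, where $\mu\in\mathbb R^n$ is arbitrary (not assumed to lie in the column space of $X$) and $\sigma>0$. $\hat\sigma>0$ is a random variable with $\hat\sigma^2\sim\sigma^2\chi^2_r/r$ ($r$ degrees of freedom; $r=\infty$ means $\hat\sigma=\sigma$), independent of all least squares estimates below. Submodels. For nonempty $M\subset\{1,\dots,p\}$, $X_M$ is the submatrix of columns indexed by $M$. $\mathcal M_{\mathrm{all}}=\{M: M\ne\varnothing,\ \operatorname{rank}(X_M)=|M|\}$. $\mathcal M$ is a fixed nonempty subset of $\mathcal M_{\mathrm{all}}$ with $\bigcup_{M\in\mathcal M}M=\{1,\dots,p\}$. For $M\in\mathcal M_{\mathrm{all}}$: $\hat\beta_M=(X_M^TX_M)^{-1}X_M^TY$ and $\beta_M=E[\hat\beta_M]=(X_M^TX_M)^{-1}X_M^T\mu$, with components $\hat\beta_{j\cdot M},\beta_{j\cdot M}$ indexed by $j\in M$. $X_{j\cdot M}$ ($j\in M$) is the residual vector of $X_j$ after orthogonal projection onto the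 span of $\{X_k:k\in M\setminus\{j\}\}$ (equal to $X_j$ if $M=\{j\}$). Define $$t_{j\cdot M}=\frac{\hat\beta_{j\cdot M}-\beta_{j\cdot M}}{\hat\sigma/\|X_{j\cdot M}\|}.$$ Confidence intervals: $\mathrm{CI}_{j\cdot M}(K)=[\hat\beta_{j\cdot M}-K\hat\sigma/\|X_{j\cdot M}\|,\ \hat\beta_{j\cdot M}+K\hat\sigma/\|X_{j\cdot M}\|]$. PoSI constant. For $\alpha\in(0,1)$, $K(X,\mathcal M,\alpha,r)$ is the minimal $K$ with $P[\max_{M\in\mathcal M}\max_{j\in M}|t_{j\cdot M}|\le K]\ge1-\alpha$. *)

(* Defs.v *)
From HB Require Import structures.
From mathcomp Require Import all_boot all_order all_algebra.
From mathcomp Require Import all_classical all_reals all_analysis.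
Set Implicit Arguments.
Unset Strict Implicit.
Unset Printing Implicit Defensive.
Import Order.TTheory GRing.Theory Num.Theory.
Import numFieldNormedType.Exports.
Local Open Scope classical_set_scope.
Local Open Scope ring_scope.

(* MathComp-Analysis, over an arbitrary R : realType.  A submodel is a finite
   set M : {set 'I_p}.  A regressor j \in M is addressed by its rank
   k : 'I_#|M| in the enumeration of M, j = enum_val k, so that "for all j in M"
   reads "for all k : 'I_#|M|" and hat beta_M is a vector of size #|M|.
   R^n appears as n.-tuple R, whose sigma-algebra (the product of the Borel
   sigma-algebras) is the Borel sigma-algebra, whenever measurability matters,
   and as 'cV[R]_n for linear algebra. *)

Section Regression.
Context {R : realType} {n p : nat}.
Implicit Types (X : 'M[R]_(n, p)) (M : {set 'I_p}) (v : 'cV[R]_n).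

(* The library norm on matrices is the sup norm. *)
Definition l2norm v : R := Num.sqrt (\sum_(i < n) v i ord0 ^+ 2).

Definition col_tuple (y : n.-tuple R) : 'cV[R]_n := \col_i tnth y i.

Definition submodel X M : 'M[R]_(n, #|M|) :=
  colsub (fun k : 'I_#|M| => enum_val k) X.

Definition full_rank_models X : {set {set 'I_p}} :=
  finset (fun M : {set 'I_p} =>
    (M != finset.set0) && (\rank (submodel X M) == #|M|)).

(* lse X M y is the least squares estimate hat beta_M; by linearity of the
   expectation, lse X M mu is the target beta_M = E[hat beta_M]. *)
Definition lse X M v : 'cV[R]_#|M| :=
  let XM := submodel X M in invmx (XM^T *m XM) *m XM^T *m v.

(* Orthogonal projection of v onto the span of the columns of X indexed by M,
   when those columns are linearly independent (0 when M is empty). *)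
Definition col_proj X M v : 'cV[R]_n := submodel X M *m lse X M v.

Definition residual X M (k : 'I_#|M|) : 'cV[R]_n :=
  let j := enum_val k in col j X - col_proj X (M :\ j)%SET (col j X).

Definition t_stat X M (k : 'I_#|M|) (v mu : 'cV[R]_n) (s : R) : R :=
  (lse X M v k ord0 - lse X M mu k ord0) / (s / l2norm (residual X k)).

(* All terms are nonnegative, so 0 is a neutral default value. *)
Definition max_abs_t X (Ms : {set {set 'I_p}}) (v mu : 'cV[R]_n) (s : R) : R :=
  \big[Num.max/0]_(M in Ms) \big[Num.max/0]_(k < #|M|) `|t_stat X k v mu s|.

Definition conf_int X M (k : 'I_#|M|) (K : R) v (s : R) : interval R :=
  let b := lse X M v k ord0 in
  let h := K * s / l2norm (residual X k) in
  `[b - h, b + h].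

End Regression.

Section Distributions.
Context {R : realType}.

Definition Gamma_fun (a : R) : R :=
  \int[lebesgue_measure]_(x in `]0, +oo[) (x `^ (a - 1) * expR (- x)).

Definition chi2_pdf (r : R) : R -> R :=
  (fun x => x `^ (r / 2 - 1) * expR (- x / 2)
            / (2 `^ (r / 2) * Gamma_fun (r / 2))) \_ `]0, +oo[.

Definition chi2_prob (r : R) (V : set R) : \bar R :=
  (\int[lebesgue_measure]_(x in V) (chi2_pdf r x)%:E)%E.

End Distributions.

Section Model.
Context {R : realType} {n p : nat}.
Context {d : measure_display} {T : measurableType d} {P : probability T R}.
Implicit Types (X : 'M[R]_(n, p)) (Y : {RV P >-> n.-tuple R}) (S : {RV P >-> R}).

(* Y ~ N(mu, sigma^2 I_n): the law of Y is the product of the N(mu_i, sigma^2);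
   the second argument of normal_prob is the standard deviation. *)
Definition spherical_normal Y (mu : 'cV[R]_n) (sigma : R) : Prop :=
  forall A : 'I_n -> set R, (forall i, measurable (A i)) ->
    distribution P Y [set y | forall i, A i (tnth y i)] =
    (\prod_(i < n) normal_prob (mu i ord0) sigma (A i))%E.

(* S^2 ~ sigma^2 chi^2_r / r, and S = sigma if r = +oo *)
Definition scale_law S (sigma : R) (r : \bar R) : Prop :=
  match r with
  | q%:E => forall B : set R, measurable B ->
      P [set w | B (q * S w ^+ 2 / sigma ^+ 2)] = chi2_prob q B
  | +oo%E => forall w, S w = sigma
  | -oo%E => False
  end.

(* The sigma-algebra generated by all the least squares estimates
   hat beta_{j.M}, for M of full rank and j in M. *)
Definition lse_events X Y : set (set T) :=
  <<s [set A | exists (M : {set 'I_p}) (k : 'I_#|M|) (B : set R),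
        [/\ M \in full_rank_models X, measurable B &
            A = [set w | B (lse X M (col_tuple (Y w)) k ord0)]]] >>.

Definition indep_lse X Y S : Prop :=
  forall (A : set T) (B : set R), lse_events X Y A -> measurable B ->
    P (A `&` S @^-1` B) = (P A * P (S @^-1` B))%E.

Definition posi_model X (r : \bar R) Y S (mu : 'cV[R]_n) (sigma : R) : Prop :=
  [/\ 0 < sigma, spherical_normal Y mu sigma, (forall w, 0 < S w),
      scale_law S sigma r & indep_lse X Y S].

End Model.

(* The law of max |t| is the same for every model with design X and r degrees of
   freedom, whatever mu and sigma are, so that the levels K below do not depend
   on the model; the infimum is attained (right-continuity of the distribution
   function), i.e. it is the minimal K. *)
Definition posi_constant (R : realType) (n p : nat) (X : 'M[R]_(n, p))
    (Ms : {set {set 'I_p}}) (alpha : R) (r : \bar R) : R :=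
  inf [set K : R |
    exists (d : measure_display) (T : measurableType d) (P : probability T R)
           (Y : {RV P >-> n.-tuple R}) (S : {RV P >-> R})
           (mu : 'cV[R]_n) (sigma : R),
      posi_model X r Y S mu sigma /\
      ((1 - alpha)%:E <=
        P [set w | max_abs_t X Ms (col_tuple (Y w)) mu (S w) <= K]%R)%E].

(* Main.v *)
Require Import Defs.
From HB Require Import structures.
From mathcomp Require Import all_boot all_order all_algebra.
From mathcomp Require Import all_classical all_reals all_analysis.
From mathcomp Require Import measurable_realfun ring.
Import Order.TTheory GRing.Theory Num.Theory.
Import numFieldNormedType.Exports.
Local Open Scope classical_set_scope.
Local Open Scope ring_scope.

(** Fix a realization for which every statistic |t_{j.M}|, with M in the family
    and j in M, is at most K.  Then beta_{j.M} lies in CI_{j.M}(K) for all these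
    M and j at once, in particular for the selected M, however it was selected.
    The event [max|t| <= K] is thus contained in the coverage event, and the
    theorem only needs [P(max|t| <= K) >= 1 - alpha] at the PoSI constant K.

    The PoSI constant is an infimum over the levels K of all the models sharing
    the design and the degrees of freedom, so one has to know that these models
    give [max|t|] the same law ([max_abs_t_law_unique]).  By linearity of least
    squares, [max|t|] is a fixed function of the standardized noise
    (Y - mu) / sigma, divided by S / sigma ([max_abs_t_standardize]).  The noise is
    standard normal, the ratio has the law prescribed by r, and both parts are
    independent; as an independent pair has its law determined by the marginals
    ([indep_pair_law]), the law of the quotient depends on neither mu nor sigma.
    The constant is then a quantile of one distribution function, and
    right-continuity shows that it is attained ([posi_constant_attained]).

    Passing from |t_{j.M}| <= K to beta_{j.M} in CI_{j.M}(K) divides by the norm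
    of X_{j.M}, which is positive because M has full rank ([residual_neq0]). *)

(** * Standardization of the normal law *)

Section AffineChange.
Context {R : realType} (m s : R).
Hypothesis s_gt0 : 0 < s.

Definition standardize (x : R) : R := (x - m) / s.

Lemma measurable_standardize : measurable_fun setT standardize.
Proof. by apply: measurable_funM => //; exact: measurable_funB. Qed.

Let s_ge0 : 0 <= s^-1. Proof. by rewrite invr_ge0 ltW. Qed.

(** Uniqueness of Lebesgue measure reduces the change of variables to half-open
    intervals, whose length standardization divides by [s]. *)
Lemma lebesgue_measure_standardize (A : set (measurableTypeR R)) :
  measurable A ->
  lebesgue_measure A =
  (s^-1%:E * pushforward lebesgue_measure (standardize : _ -> measurableTypeR R) A)%E.
Proof.
move=> mA.
apply: (@lebesgue_measure_unique R (mscale (NngNum s_ge0)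
  (pushforward lebesgue_measure (standardize : _ -> measurableTypeR R)))) => //.
  exact: measurable_standardize.
move=> mS _ [[a b]] _ <-.
rewrite -[RHS]/(s^-1%:E * lebesgue_measure (standardize @^-1` `]a, b]))%E.
have -> : standardize @^-1` `]a, b] = `]s * a + m, s * b + m]%classic.
  apply/seteqP; split=> x /=; rewrite !in_itv /standardize /=;
    by rewrite ltr_pdivlMr// ler_pdivrMr// ltrBrDr lerBlDr ![_ * s]mulrC.
rewrite !lebesgue_measure_itv/= !lte_fin ltrD2r ltr_pM2l//.
case: ifP => ab; last by rewrite mule0.
rewrite -!EFinB -EFinM; congr EFin.
by field; rewrite gt_eqF.
Qed.

Lemma normal_pdf_standardize x :
  normal_pdf m s x = s^-1 * normal_pdf 0 1 (standardize x).
Proof.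
rewrite !normal_pdfE ?gt_eqF// mulrA; congr (_ * _).
  rewrite /normal_peak expr1n mul1r -mulrnAr sqrtrM ?sqr_ge0//.
  by rewrite sqrtr_sqr gtr0_norm// invfM.
rewrite /normal_fun; congr expR.
by rewrite subr0 /standardize; field; rewrite gt_eqF.
Qed.

(** Any normal law is an affine image of N(0,1): the factor [s^-1] relating the
    densities cancels the Jacobian of the standardization. *)
Lemma normal_prob_standardize (A : set R) : measurable A ->
  normal_prob m s (standardize @^-1` A) = normal_prob 0 1 A.
Proof.
move=> mA; rewrite /normal_prob.
under eq_integral do rewrite normal_pdf_standardize.
have mpdf : measurable_fun A (fun x : R => (normal_pdf 0 1 x)%:E).
  by apply/measurable_funTS/measurable_EFinP; exact: measurable_normal_pdf.
rewrite -(@ge0_integral_pushforward _ _ (measurableTypeR R) (measurableTypeR R) R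
  standardize measurable_standardize lebesgue_measure A (fun y => (s^-1 * normal_pdf 0 1 y)%:E)) //.
- transitivity (\int[mscale (NngNum (ltW s_gt0)) lebesgue_measure]_(x in A)
      (s^-1 * normal_pdf 0 1 x)%:E)%E.
    apply: eq_measure_integral; first exact: measurable_standardize.
    move=> mS B mB _; rewrite -[RHS]/(s%:E * lebesgue_measure B)%E.
    rewrite (lebesgue_measure_standardize B)//.
    by rewrite muleA -EFinM mulfV ?gt_eqF// mul1e.
  rewrite ge0_integral_mscale//=; last 2 first.
  + by apply/measurable_EFinP/measurable_funM => //; exact/measurable_EFinP.
  + by move=> x _; rewrite lee_fin mulr_ge0// normal_pdf_ge0.
  under eq_integral do rewrite EFinM.
  rewrite ge0_integralZl//; last by move=> x _; rewrite lee_fin normal_pdf_ge0.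
  by rewrite muleA -EFinM mulfV ?gt_eqF// mul1e.
- by apply/measurable_EFinP/measurable_funM => //; exact/measurable_EFinP.
- by move=> x _; rewrite lee_fin mulr_ge0// normal_pdf_ge0.
Qed.

End AffineChange.

(** * Linear algebra of the t statistics *)

Section LinearAlgebra.
Context {R : realType} {n p : nat}.
Implicit Types (X : 'M[R]_(n, p)) (M : {set 'I_p}) (v w : 'cV[R]_n).

Lemma l2norm_gt0 v : v != 0 -> 0 < l2norm v.
Proof.
move=> v0; rewrite /l2norm sqrtr_gt0 lt_neqAle sumr_ge0 ?andbT; last first.
  by move=> i _; exact: sqr_ge0.
apply: contra v0; rewrite eq_sym psumr_eq0 => [/allP v0|i _]; last exact: sqr_ge0.
apply/eqP/matrixP => i j; rewrite ord1 mxE.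
by have := v0 i (mem_index_enum i); rewrite sqrf_eq0 => /eqP.
Qed.

(** A vanishing residual would express column [j] of the submodel through the
    other ones, contradicting its full column rank.  This is what makes the
    half-width of the confidence intervals a genuine division. *)
Lemma residual_neq0 X M (k : 'I_#|M|) :
  M \in full_rank_models X -> residual X k != 0.
Proof.
rewrite inE => /andP[_ /eqP rkM]; apply/negP => /eqP res0.
pose j := enum_val k; pose N := (M :\ j)%SET.
have jM : j \in M by exact: enum_valP.
(* [b i] is the coefficient of column [i] in the projection of column [j], and
   [X_M *m u] is the residual of column [j]. *)
pose a : 'cV[R]_#|N| := lse X N (col j X).
pose b i : R := \sum_(l < #|N| | enum_val l == i) a l ord0.
pose u : 'cV[R]_#|M| := \col_l ((l == k)%:R - b (enum_val l)).
have free : row_free (submodel X M)^T by rewrite /row_free mxrank_tr rkM.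
have : submodel X M *m u = 0.
  rewrite -[RHS]res0; apply/matrixP => i q; rewrite ord1 !mxE.
  under eq_bigr do rewrite !mxE mulrBr.
  rewrite big_split /= sumrN; congr (_ - _).
    by rewrite (bigD1 k)//= eqxx mulr1 big1 ?addr0// => l /negPf ->; rewrite mulr0.
  transitivity (\sum_(i0 < #|M|) \sum_(l < #|N| | enum_val l == enum_val i0)
      X i (enum_val i0) * a l ord0).
    by apply: eq_bigr => i0 _; rewrite mulr_sumr.
  rewrite (exchange_big_dep predT)//=; apply: eq_bigr => l _.
  have lM : enum_val l \in M.
    by have := enum_valP l; rewrite inE => /andP[].
  rewrite (big_pred1 (enum_rank_in jM (enum_val l))); last first.
    move=> q' /=; apply/eqP/eqP => [->|->]; first by rewrite enum_valK_in.
    by rewrite enum_rankK_in.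
  by rewrite !mxE enum_rankK_in.
move=> /(congr1 trmx); rewrite trmx_mul trmx0 => /(canRL (mulmxKp free)).
rewrite mul0mx => /matrixP /(_ ord0 k); rewrite !mxE eqxx.
rewrite /b big1 ?subr0; first by move/eqP; rewrite oner_eq0.
move=> l /eqP e; have := enum_valP l; rewrite e /N inE.
by rewrite /= !inE eqxx.
Qed.

Lemma lseB X M v w : lse X M (v - w) = lse X M v - lse X M w.
Proof. by rewrite /lse mulmxBr. Qed.

Lemma lseZ X M (c : R) v : lse X M (c *: v) = c *: lse X M v.
Proof. by rewrite /lse scalemxAr. Qed.

Lemma bigmax_homog (I : Type) (s : seq I) (Q : pred I) (c : R) (F : I -> R) :
  0 <= c -> \big[Num.max/0]_(i <- s | Q i) (c * F i) =
            c * \big[Num.max/0]_(i <- s | Q i) F i.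
Proof.
move=> c0; rewrite (big_morph ( *%R c) (id1 := 0) (op1 := Num.max)) ?mulr0//.
by move=> x y; rewrite maxr_pMr.
Qed.

(** The least squares estimates are linear, so the maximal |t| statistic is the
    same functional of the standardized noise [sigma^-1 *: (v - mu)], divided by
    the ratio [s / sigma]: the parameters enter through these two alone. *)
Lemma max_abs_t_standardize X (Ms : {set {set 'I_p}}) v mu (s sigma : R) :
  0 < s -> 0 < sigma ->
  max_abs_t X Ms v mu s = max_abs_t X Ms (sigma^-1 *: (v - mu)) 0 1 / (s / sigma).
Proof.
move=> s0 sg0; rewrite /max_abs_t mulrC.
rewrite -bigmax_homog ?invr_ge0 ?divr_ge0 ?ltW//.
apply: eq_bigr => M _; rewrite -bigmax_homog ?invr_ge0 ?divr_ge0 ?ltW//.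
apply: eq_bigr => k _; rewrite /t_stat.
rewrite -[X in X * `|_|]gtr0_norm ?invr_gt0 ?divr_gt0// -normrM; congr `|_|.
rewrite lseZ lseB -(subrr 0) lseB subrr !mxE subr0 mul1r !invfM !invrK.
by field; rewrite !gt_eqF.
Qed.

End LinearAlgebra.

(** * Uniqueness of joint laws *)

Section JointLaws.
Context {R : realType}.

(** Boxes are stable under intersection and generate the product sigma-algebra,
    so that the law of a random vector is determined by its values on them. *)
Lemma tuple_measure_unique (n : nat) (m1 m2 : probability (n.-tuple R) R) :
  (forall A : 'I_n -> set R, (forall i, measurable (A i)) ->
     m1 [set y | forall i, A i (tnth y i)] = m2 [set y | forall i, A i (tnth y i)]) ->
  forall E, measurable E -> m1 E = m2 E.
Proof.
move=> m12 E mE.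
pose box (A : 'I_n -> set R) : set (n.-tuple R) :=
  [set y | forall i, A i (tnth y i)].
pose G : set (set (n.-tuple R)) :=
  [set box A | A in [set A | forall i, measurable (A i)]].
apply: (g_sigma_algebra_measure_unique G _ (fun=> setT)).
- move=> _ [A mA <-].
  have -> : box A = \bigcap_(i in [set: 'I_n]) ((fun y => tnth y i) @^-1` A i).
    by apply/seteqP; split=> y yA i //=; exact: yA.
  apply: fin_bigcap_measurable => // i _.
  by rewrite -[X in measurable X]setTI; exact: measurable_tnth.
- move=> _; exists (fun=> setT) => //.
  by rewrite -subTset => y _ i.
- by rewrite bigcup_const//; exists 0%N.
- move=> _ _ [A mA <-] [B mB <-]; exists (fun i => A i `&` B i).
    by move=> i; exact: measurableI.
  apply/seteqP; split=> y /=; first by move=> yAB; split=> i; have [] := yAB i.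
  by move=> [yA yB] i; split; [exact: yA|exact: yB].
- by move=> _ [A mA <-]; exact: m12.
- by move=> _; rewrite (le_lt_trans (probability_le1 _ _))// ltry.
move: E mE; apply: smallest_sub; first exact: smallest_sigma_algebra.
apply: (big_ind (fun S : set (set (n.-tuple R)) => S `<=` <<s G >>)) => //.
- by move=> S1 S2 S1G S2G C [/S1G|/S2G].
- move=> i _ _ [B mB <-]; apply: sub_sigma_algebra.
  exists (fun k => if k == i then B else setT).
    by move=> k; case: ifP.
  apply/seteqP; split=> y /=; first by move=> /(_ i); rewrite eqxx.
  by move=> [_ yB] k; case: eqP => [->|].
Qed.

(** Both joint laws are the product of the common marginals. *)
Lemma indep_pair_law d (T : measurableType d) (P : probability T R)
    d' (T' : measurableType d') (P' : probability T' R)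
    (G Q : {RV P >-> R}) (G' Q' : {RV P' >-> R}) :
  (forall A, measurable A -> P (G @^-1` A) = P' (G' @^-1` A)) ->
  (forall B, measurable B -> P (Q @^-1` B) = P' (Q' @^-1` B)) ->
  (forall A B, measurable A -> measurable B ->
     P (G @^-1` A `&` Q @^-1` B) = (P (G @^-1` A) * P (Q @^-1` B))%E) ->
  (forall A B, measurable A -> measurable B ->
     P' (G' @^-1` A `&` Q' @^-1` B) = (P' (G' @^-1` A) * P' (Q' @^-1` B))%E) ->
  forall C : set (R * R), measurable C ->
    P [set w | C (G w, Q w)] = P' [set w | C (G' w, Q' w)].
Proof.
move=> GG QQ GQ GQ' C mC.
have mp d0 (T0 : measurableType d0) (f g : {mfun T0 >-> R}) :
    measurable_fun setT (fun w => (f w, g w)).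
  by apply/measurable_fun_pairP; split; exact: measurable_funPT.
pose GQm : {mfun T >-> (R * R)%type} := mfun_Sub (mem_set (mp _ _ G Q)).
pose GQm' : {mfun T' >-> (R * R)%type} := mfun_Sub (mem_set (mp _ _ G' Q')).
have m1 : ((distribution P G \x distribution P Q) C = distribution P GQm C)%E.
  by apply: product_measure_unique => // A B mA mB; exact: GQ.
have m2 : ((distribution P G \x distribution P Q) C = distribution P' GQm' C)%E.
  apply: product_measure_unique => // A B mA mB.
  by have := GQ' A B mA mB; rewrite -GG// -QQ.
exact: (etrans (esym m1) m2).
Qed.

End JointLaws.

(** * Measurability of the maximal |t| *)

Section Measurability.
Context {R : realType} {n p : nat}.
Context {d : measure_display} {T : measurableType d}.
Implicit Types (X : 'M[R]_(n, p)) (Ms : {set {set 'I_p}}).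

Lemma measurable_sublevel (f : T -> R) (K : R) :
  measurable_fun setT f -> measurable [set w | f w <= K].
Proof.
move=> mf; have -> : [set w | f w <= K] = f @^-1` `]-oo, K].
  by apply/seteqP; split=> w; rewrite /= in_itv.
by rewrite -[X in measurable X]setTI; exact: mf.
Qed.

Lemma measurable_bigmax (I : Type) (s : seq I) (Q : pred I) (F : I -> T -> R) :
  (forall i, Q i -> measurable_fun setT (F i)) ->
  measurable_fun setT (fun w => \big[Num.max/0]_(i <- s | Q i) F i w).
Proof.
move=> mF; elim: s => [|i s IHs].
  under eq_fun do rewrite big_nil.
  exact: measurable_cst.
under eq_fun do rewrite big_cons.
have := mF i; case: (Q i) => [/(_ isT) mFi|_//].
exact: measurable_maxr.
Qed.

(** Only the measurability of the estimates is assumed, so that the lemma also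
    applies to the sigma-algebra that they generate. *)
Lemma measurable_max_abs_t X Ms (f : T -> 'cV[R]_n) (mu : 'cV[R]_n) (s : R) :
  (forall (M : {set 'I_p}) (k : 'I_#|M|), M \in Ms ->
     measurable_fun setT (fun w => lse X M (f w) k ord0)) ->
  measurable_fun setT (fun w => max_abs_t X Ms (f w) mu s).
Proof.
move=> mf; apply: measurable_bigmax => M MMs.
apply: measurable_bigmax => k _; apply: measurableT_comp => //.
apply: measurable_funM => //; apply: measurable_funB => //; exact: mf.
Qed.

Lemma measurable_lse X (M : {set 'I_p}) (k : 'I_#|M|) (Y : T -> n.-tuple R) :
  measurable_fun setT Y ->
  measurable_fun setT (fun w => lse X M (col_tuple (Y w)) k ord0).
Proof.
move=> mY; rewrite /lse /=; under eq_fun do rewrite mxE.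
apply: measurable_sum => i; apply: measurable_funM => //.
under eq_fun do rewrite mxE.
exact: (measurableT_comp (measurable_tnth i) mY).
Qed.

Lemma measurable_inv_pos (f : T -> R) : (forall w, 0 < f w) ->
  measurable_fun setT f -> measurable_fun setT (fun w => (f w)^-1).
Proof.
move=> f0 mf.
have -> : (fun w => (f w)^-1) = (fun w => f w `^ (-1)).
  by apply/funext => w; rewrite powR_inv1 ?ltW.
exact: (measurableT_comp (measurable_powR _) mf).
Qed.

End Measurability.

(** * Laws of the standardized noise and of the scale *)

Section Laws.
Context {R : realType} {n p : nat}.

Definition std_tuple (mu : 'cV[R]_n) (sigma : R) (y : n.-tuple R) : n.-tuple R :=
  [tuple standardize (mu i ord0) sigma (tnth y i) | i < n].

Lemma col_std_tuple mu sigma y :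
  col_tuple (std_tuple mu sigma y) = sigma^-1 *: (col_tuple y - mu).
Proof.
apply/matrixP => i j; rewrite ord1 !mxE tnth_mktuple.
by rewrite /standardize mulrC.
Qed.

Lemma measurable_std_tuple mu sigma :
  measurable_fun setT (std_tuple mu sigma).
Proof.
apply/measurable_fun_tnthP => i.
have -> : (fun y => tnth y i) \o std_tuple mu sigma =
    standardize (mu i ord0) sigma \o (fun y => tnth y i).
  by apply/funext => y /=; rewrite tnth_mktuple.
exact: (measurableT_comp (measurable_standardize _ _) (measurable_tnth i)).
Qed.

Context {d : measure_display} {T : measurableType d} {P : probability T R}.
Implicit Types (Y : {RV P >-> n.-tuple R}) (S : {RV P >-> R}).

Lemma spherical_normal_std Y mu sigma (A : 'I_n -> set R) :
  0 < sigma -> spherical_normal Y mu sigma -> (forall i, measurable (A i)) ->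
  P [set w | forall i, A i (tnth (std_tuple mu sigma (Y w)) i)] =
  (\prod_(i < n) normal_prob 0 1 (A i))%E.
Proof.
move=> sg0 YN mA.
pose B i := standardize (mu i ord0) sigma @^-1` A i.
have mB i : measurable (B i).
  by rewrite -[B i]setTI; apply: measurable_standardize.
transitivity (distribution P Y [set y | forall i, B i (tnth y i)]).
  congr (P _); apply/seteqP; split=> w /= wA i; have := wA i;
    by rewrite tnth_mktuple.
by rewrite (YN B mB); apply: eq_bigr => i _; exact: normal_prob_standardize.
Qed.

(** As [S] is positive, [S / sigma] is recovered from its square, a chi-square
    variable divided by its number [q] of degrees of freedom.  The power
    [2^-1] stands for the square root. *)
Lemma scale_law_ratio S sigma (q : R) (B : set R) :
  0 < sigma -> 0 < q -> (forall w, 0 < S w) -> scale_law S sigma q%:E ->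
  measurable B ->
  P [set w | B (S w / sigma)] = chi2_prob q [set x | B ((x / q) `^ 2^-1)].
Proof.
move=> sg0 q0 S0 Slaw mB.
have mroot : measurable_fun setT (fun x : R => (x / q) `^ 2^-1).
  exact: (measurableT_comp (measurable_powR _) (mulrr_measurable _)).
rewrite -Slaw; last first.
  by rewrite -[X in measurable X]setTI; exact: mroot.
congr (P _); apply: eq_set => w; congr B.
have -> : q * S w ^+ 2 / sigma ^+ 2 / q = (S w / sigma) ^+ 2.
  by field; rewrite !gt_eqF.
by rewrite powR12_sqrt ?sqr_ge0// sqrtr_sqr ger0_norm// divr_ge0// ltW.
Qed.

(** At a deterministic scale, the maximal |t| is a function of the least squares
    estimates alone; its events are therefore among those that a model declares
    independent of the random scale. *)
Lemma max_abs_t_lse_event (X : 'M[R]_(n, p)) (Ms : {set {set 'I_p}}) Y mu (s : R)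
    (A : set R) :
  Ms \subset full_rank_models X -> measurable A ->
  lse_events X Y ((fun w => max_abs_t X Ms (col_tuple (Y w)) mu s) @^-1` A).
Proof.
move=> MsX mA.
pose G : set (set T) := [set A | exists (M : {set 'I_p}) (k : 'I_#|M|) (B : set R),
  [/\ M \in full_rank_models X, measurable B &
      A = [set w | B (lse X M (col_tuple (Y w)) k ord0)]]].
suff mt : @measurable_fun _ _ (g_sigma_algebraType G) R setT
    (fun w => max_abs_t X Ms (col_tuple (Y w)) mu s).
  by have := mt measurableT A mA; rewrite setTI.
apply: measurable_max_abs_t => M k MMs _ B mB; rewrite setTI.
apply: sub_sigma_algebra; exists M, k, B; split => //.
exact: (fintype.subsetP MsX).
Qed.

(** Division by the random scale is taken out of the maximum, as the measurable
    inverse of a positive function. *)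
Lemma measurable_max_abs_t_scale (X : 'M[R]_(n, p)) (Ms : {set {set 'I_p}}) Y S mu :
  (forall w, 0 < S w) ->
  measurable_fun setT (fun w => max_abs_t X Ms (col_tuple (Y w)) mu (S w)).
Proof.
move=> S0; have -> : (fun w => max_abs_t X Ms (col_tuple (Y w)) mu (S w)) =
    (fun w => max_abs_t X Ms (col_tuple (Y w)) mu 1 * (S w)^-1).
  apply/funext => w; rewrite (max_abs_t_standardize _ _ _ _ (S w) 1)// divr1.
  by rewrite [in RHS](max_abs_t_standardize _ _ _ _ 1 1)// divr1 divr1.
apply: measurable_funM; last by apply: measurable_inv_pos.
by apply: measurable_max_abs_t => M k _; exact: measurable_lse.
Qed.

End Laws.

(** * The maximal |t| and the PoSI constant *)

Section PosiConstant.
Context {R : realType} {n p : nat}.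
Implicit Types (X : 'M[R]_(n, p)) (Ms : {set {set 'I_p}}).

(** [max|t| <= K] is the event [G <= K * Q] where [G], the maximum computed at the
    scale [sigma], is a function of standard normal noise, and [Q = S / sigma] is
    independent of [G].  The laws of [G] and [Q] are the same in all models. *)
Lemma max_abs_t_law_unique X Ms (r : \bar R)
    d (T : measurableType d) (P : probability T R)
    (Y : {RV P >-> n.-tuple R}) (S : {RV P >-> R}) (mu : 'cV[R]_n) (sigma : R)
    d' (T' : measurableType d') (P' : probability T' R)
    (Y' : {RV P' >-> n.-tuple R}) (S' : {RV P' >-> R}) (mu' : 'cV[R]_n)
    (sigma' : R) (K : R) :
  Ms \subset full_rank_models X -> (0 < r)%E ->
  posi_model X r Y S mu sigma -> posi_model X r Y' S' mu' sigma' ->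
  P [set w | max_abs_t X Ms (col_tuple (Y w)) mu (S w) <= K] =
  P' [set w | max_abs_t X Ms (col_tuple (Y' w)) mu' (S' w) <= K].
Proof.
move=> MsX r0 [sg0 YN Spos Slaw indep] [sg0' YN' Spos' Slaw' indep'].
have mG d0 (T0 : measurableType d0) (Y0 : {mfun T0 >-> n.-tuple R}) mu0 (sigma0 : R) :
    measurable_fun setT (fun w => max_abs_t X Ms (col_tuple (Y0 w)) mu0 sigma0).
  by apply: measurable_max_abs_t => M k _; exact: measurable_lse.
have mQ d0 (T0 : measurableType d0) (S0 : {mfun T0 >-> R}) (sigma0 : R) :
    measurable_fun setT (fun w => S0 w / sigma0).
  by apply: measurable_funM => //; exact: measurable_funPT.
pose G : {RV P >-> R} := mfun_Sub (mem_set (mG _ _ Y mu sigma)).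
pose Q : {RV P >-> R} := mfun_Sub (mem_set (mQ _ _ S sigma)).
pose G' : {RV P' >-> R} := mfun_Sub (mem_set (mG _ _ Y' mu' sigma')).
pose Q' : {RV P' >-> R} := mfun_Sub (mem_set (mQ _ _ S' sigma')).
pose C : set (R * R) := [set gq | gq.1 <= K * gq.2].
have maxE v (mu0 : 'cV[R]_n) s sigma0 : 0 < s -> 0 < sigma0 ->
    (max_abs_t X Ms v mu0 s <= K) =
    (max_abs_t X Ms v mu0 sigma0 <= K * (s / sigma0)).
  move=> s_gt0 sigma0_gt0.
  rewrite (max_abs_t_standardize _ _ _ _ s sigma0)//.
  rewrite (max_abs_t_standardize _ _ _ _ sigma0 sigma0)//.
  by rewrite divff ?gt_eqF// divr1 ler_pdivrMr// divr_gt0.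
have mC : measurable C.
  rewrite (_ : C = [set gq | gq.1 - K * gq.2 <= 0]).
    apply: measurable_sublevel.
    by apply: measurable_funB => //; apply: measurable_funM.
  by apply: eq_set => gq; rewrite subr_le0.
transitivity (P [set w | C (G w, Q w)]).
  by congr (P _); apply: eq_set => w; rewrite (maxE _ _ _ sigma).
transitivity (P' [set w | C (G' w, Q' w)]); last first.
  by congr (P' _); apply: eq_set => w; rewrite (maxE _ _ _ sigma').
apply: indep_pair_law => //.
- move=> A mA.
  pose h (z : n.-tuple R) := max_abs_t X Ms (col_tuple z) 0 1.
  have mh : measurable_fun setT h.
    by apply: measurable_max_abs_t => M k _; exact: measurable_lse.
  have mstd d0 (T0 : measurableType d0) (Y0 : {mfun T0 >-> n.-tuple R}) mu0
      (sigma0 : R) : measurable_fun setT (fun w => std_tuple mu0 sigma0 (Y0 w)).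
    by apply: (measurableT_comp (measurable_std_tuple _ _)); exact: measurable_funPT.
  have GE (v : n.-tuple R) mu0 sigma0 : 0 < sigma0 ->
      max_abs_t X Ms (col_tuple v) mu0 sigma0 = h (std_tuple mu0 sigma0 v).
    move=> sigma0_gt0; rewrite (max_abs_t_standardize _ _ _ _ sigma0 sigma0)//.
    by rewrite divff ?gt_eqF// divr1 /h col_std_tuple.
  pose Z : {RV P >-> n.-tuple R} := mfun_Sub (mem_set (mstd _ _ Y mu sigma)).
  pose Z' : {RV P' >-> n.-tuple R} := mfun_Sub (mem_set (mstd _ _ Y' mu' sigma')).
  have mhA : measurable (h @^-1` A) by rewrite -[X in measurable X]setTI; exact: mh.
  have ZZ' := @tuple_measure_unique R n (distribution P Z) (distribution P' Z') _ _ mhA.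
  transitivity (distribution P Z (h @^-1` A)).
    by congr (P _); apply: eq_set => w /=; rewrite GE.
  rewrite ZZ'; last first.
    move=> B mB; exact: (etrans (spherical_normal_std Y mu sigma B sg0 YN mB)
      (esym (spherical_normal_std Y' mu' sigma' B sg0' YN' mB))).
  by congr (P' _); apply: eq_set => w /=; rewrite GE.
(* With infinitely many degrees of freedom, [Q] is the constant 1. *)
- move=> B mB; case: r r0 Slaw Slaw' {indep indep'} => [q q0 Slaw Slaw'|_ SE SE'|//].
    rewrite lte_fin in q0.
    transitivity (chi2_prob q [set x | B ((x / q) `^ 2^-1)]).
      exact: scale_law_ratio.
    by apply/esym; exact: scale_law_ratio.
  have [B1|B1] := pselect (B 1).
    rewrite (_ : _ @^-1` _ = setT) ?probability_setT; last first.
      by rewrite -subTset => w _ /=; rewrite SE divff ?gt_eqF.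
    rewrite (_ : _ @^-1` _ = setT) ?probability_setT//.
    by rewrite -subTset => w _ /=; rewrite SE' divff ?gt_eqF.
  rewrite (_ : _ @^-1` _ = set0) ?measure0; last first.
    by rewrite -subset0 => w /=; rewrite SE divff ?gt_eqF.
  rewrite (_ : _ @^-1` _ = set0) ?measure0//.
  by rewrite -subset0 => w /=; rewrite SE' divff ?gt_eqF.
- move=> A B mA mB.
  have mB' : measurable [set s | B (s / sigma)].
    by have := mulrr_measurable (D:=setT) sigma^-1 measurableT mB; rewrite setTI.
  exact: (indep _ _ (max_abs_t_lse_event X Ms Y mu sigma A MsX mA) mB').
- move=> A B mA mB.
  have mB' : measurable [set s | B (s / sigma')].
    by have := mulrr_measurable (D:=setT) sigma'^-1 measurableT mB; rewrite setTI.
  exact: (indep' _ _ (max_abs_t_lse_event X Ms Y' mu' sigma' A MsX mA) mB').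
Qed.

Lemma le_max_abs_t X Ms v mu s (M : {set 'I_p}) (k : 'I_#|M|) : M \in Ms ->
  `|t_stat X k v mu s| <= max_abs_t X Ms v mu s.
Proof.
move=> MMs; rewrite /max_abs_t.
apply: (bigmax_sup M) => //.
exact: (le_bigmax 0 (fun k => `|t_stat X k v mu s|)).
Qed.

Lemma max_abs_t_ge0 X Ms v mu s : 0 <= max_abs_t X Ms v mu s.
Proof. exact: bigmax_ge_id. Qed.

(** By uniqueness of the law of [max|t|], the PoSI constant is the infimum of the
    levels where the distribution function of [max|t|], in any single model,
    reaches [1 - alpha]; right-continuity makes this infimum such a level. *)
Lemma posi_constant_attained X Ms (alpha : R) (r : \bar R)
    d (T : measurableType d) (P : probability T R)
    (Y : {RV P >-> n.-tuple R}) (S : {RV P >-> R}) (mu : 'cV[R]_n) (sigma : R) :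
  Ms \subset full_rank_models X -> (0 < r)%E -> 0 < alpha -> alpha < 1 ->
  posi_model X r Y S mu sigma ->
  ((1 - alpha)%:E <=
   P [set w | (max_abs_t X Ms (col_tuple (Y w)) mu (S w) <=
               posi_constant X Ms alpha r)%R])%E.
Proof.
move=> MsX r0 a0 alpha_lt1 model.
have S_gt0 : forall w, 0 < S w by case: model.
pose V : {RV P >-> R} :=
  mfun_Sub (mem_set (measurable_max_abs_t_scale X Ms Y S mu S_gt0)).
pose levels := [set K : R | ((1 - alpha)%:E <= cdf V K)%E].
have cdfVE K : cdf V K =
    P [set w | max_abs_t X Ms (col_tuple (Y w)) mu (S w) <= K].
  by congr (P _); apply: eq_set => w /=; rewrite in_itv.
have -> : posi_constant X Ms alpha r = inf levels.
  congr inf; apply/seteqP; split=> K /=.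
    move=> [d' [T' [P' [Y' [S' [mu' [sigma' [model' le']]]]]]]].
    by rewrite /levels /= cdfVE (max_abs_t_law_unique X Ms r d T P Y S mu sigma
      d' T' P' Y' S' mu' sigma' K).
  by rewrite /levels /= cdfVE => leK; exists d, T, P, Y, S, mu, sigma.
(* Negative levels have probability 0 < 1 - alpha, since [max|t| >= 0]. *)
have lb0 : lbound levels 0.
  move=> K; rewrite /levels /= => leK; rewrite leNgt; apply/negP => K0.
  move: leK; rewrite cdfVE (_ : [set w | _] = set0) ?measure0.
    by rewrite lee_fin leNgt subr_gt0 alpha_lt1.
  rewrite -subset0 => w /=; apply/negP; rewrite -ltNge.
  exact: lt_le_trans K0 (max_abs_t_ge0 _ _ _ _ _).
(* The distribution function tends to 1, above [1 - alpha]. *)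
have neq0 : levels !=set0.
  apply: contrapT => noK.
  have : (1 <= (1 - alpha)%:E)%E.
    apply: (cvge_to_le (cvg_cdfy1 V)); apply: nearW => K.
    by apply/ltW; rewrite ltNge; apply/negP => leK; apply: noK; exists K.
  by rewrite lee_fin leNgt ltrBlDr ltrDl a0.
rewrite -cdfVE.
have rc := @cdf_right_continuous _ _ _ _ V (inf levels).
apply: (cvge_to_ge rc); near=> x.
have : inf levels < x by near: x; exact: nbhs_right_gt.
move=> /inf_lt[//|K KE Kx]; apply: (le_trans KE).
by apply: cdf_nondecreasing; exact: ltW.
Unshelve. all: by end_near. Qed.

End PosiConstant.

(** * Coverage after selection *)

Lemma abs_t_stat_leE (R : realType) (n p : nat) (X : 'M[R]_(n, p))
    (M : {set 'I_p}) (k : 'I_#|M|) (v mu : 'cV[R]_n) (s K : R) :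
  M \in full_rank_models X -> 0 < s ->
  (`|t_stat X k v mu s| <= K) =
  (lse X M mu k ord0 \in conf_int X k K v s).
Proof.
move=> MX s0; have rho0 := l2norm_gt0 _ (residual_neq0 X M k MX).
rewrite /t_stat /conf_int in_itv /= -ler_distlC normrM normfV.
by rewrite [`|s / _|]gtr0_norm ?divr_gt0// ler_pdivrMr ?divr_gt0// mulrA.
Qed.

Theorem corollary4p1 (R : realType) (n p : nat) (X : 'M[R]_(n, p))
  (rankX : (1 <= \rank X)%N)
  (Ms : {set {set 'I_p}})
  (Ms_neq0 : Ms != finset.set0)
  (Ms_full_rank : Ms \subset full_rank_models X)
  (Ms_cover : finset.cover Ms = finset.setT)
  (alpha : R) (alpha_gt0 : 0 < alpha) (alpha_lt1 : alpha < 1)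
  (r : \bar R) (r_gt0 : (0 < r)%E)
  (d : measure_display) (T : measurableType d) (P : probability T R)
  (Y : {RV P >-> n.-tuple R}) (S : {RV P >-> R})
  (mu : 'cV[R]_n) (sigma : R)
  (model : posi_model X r Y S mu sigma)
  (Mhat : n.-tuple R -> {set 'I_p})
  (Mhat_in : forall y, Mhat y \in Ms)
  (Mhat_meas : forall M : {set 'I_p}, measurable (Mhat @^-1` [set M])) :
  ((1 - alpha)%:E <=
    P [set w | forall k : 'I_#|Mhat (Y w)|,
         lse X (Mhat (Y w)) mu k ord0
           \in conf_int X k (posi_constant X Ms alpha r)
                 (col_tuple (Y w)) (S w)])%E.
Proof.
have S_gt0 : forall w, 0 < S w by case: model.
set K := posi_constant X Ms alpha r.
have MX M : M \in Ms -> M \in full_rank_models X by exact: (fintype.subsetP Ms_full_rank).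
apply: (le_trans (posi_constant_attained X Ms alpha r d T P Y S mu sigma
  Ms_full_rank r_gt0 alpha_gt0 alpha_lt1 model)).
have mle : measurable [set w | max_abs_t X Ms (col_tuple (Y w)) mu (S w) <= K].
  exact: (measurable_sublevel _ _ (measurable_max_abs_t_scale X Ms Y S mu S_gt0)).
(* Monotonicity of [P] calls for the measurability of the coverage event, which
   is obtained by splitting it according to the finitely many values of
   [Mhat]. *)
apply: le_measure; rewrite ?inE//; last first.
  move=> w /= leK k; rewrite -abs_t_stat_leE ?MX//.
  exact: le_trans (le_max_abs_t _ _ _ _ _ _ _ (Mhat_in _)) leK.
rewrite (_ : [set w | _] = \bigcup_(M in [set: {set 'I_p}])
    (((Mhat \o Y) @^-1` [set M]) `&` [set w | M \in Ms /\ forall k : 'I_#|M|,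
       `|t_stat X k (col_tuple (Y w)) mu (S w)| <= K])); last first.
  apply/seteqP; split=> w /=.
    move=> cov; exists (Mhat (Y w)) => //; split=> //; split=> // k.
    by rewrite abs_t_stat_leE ?MX.
  move=> [M _ [/= <- [MMs leK]]] k.
  by rewrite -abs_t_stat_leE ?MX.
apply: fin_bigcup_measurable => // M _; apply: measurableI.
  by rewrite comp_preimage; exact: measurable_funPTI.
have [MMs|nMMs] := boolP (M \in Ms); last first.
  rewrite (_ : [set w | _] = set0) //.
  by rewrite -subset0 => w /= [].
rewrite (_ : [set w | _] = \bigcap_(k in [set: 'I_#|M|])
   [set w | `|t_stat X k (col_tuple (Y w)) mu (S w)| <= K]); last first.
  apply/seteqP; split=> w /=; first by move=> [_ leK] k _; exact: leK.
  by move=> leK; split=> // k; exact: leK.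
apply: fin_bigcap_measurable => // k _.
apply: measurable_sublevel; apply: measurableT_comp => //.
apply: measurable_funM.
  by apply: measurable_funB => //; exact: measurable_lse.
under eq_fun do rewrite invfM.
by apply: measurable_funM => //; exact: measurable_inv_pos.
Qed.
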